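(* Let $A=(a_{ij})$ be a real $n\times n$ matrix with nonnegative entries, $\mathbf 1=(1,\ldots,1)^{\mathrm T}$, $L=\operatorname{diag}(A\mathbf 1)-A$, and let $\tau$ satisfy $0<\tau\le\bigl(\max_i\sum_{j\neq i}a_{ij}\bigr)^{-1}$. Let $S$ be the orthogonal projection of $\mathbb R^n$ onto $\mathcal R(L)\oplus\operatorname{span}(\mathbf 1)$, define $\widetilde L=\tau^{-1}(I-S)+LS$, and let $\tilde J$ be the eigenprojection of $L$ corresponding to the eigenvalue $0$. If $x(t)$ is a solution of $\dot x(t)=-\widetilde L\,x(t)$, then $\lim_{t\to\infty}x(t)=\tilde J S\,x(0)$.
   Context: $\mathcal R(M)$ and $\mathcal N(M)$ denote range and null space of a matrix $M$. The index $\operatorname{ind}M$ is the smallest $k\ge0$ with $\operatorname{rank}M^{k+1}=\operatorname{rank}M^k$. The eigenprojection of $M$ corresponding to the eigenvalue $0$ is the idempotent matrix $Z$ with $\mathcal R(Z)=\mathcal N(M^{\nu})$ and $\mathcal N(Z)=\mathcal R(M^{\nu})$, where $\nu=\operatorname{ind}M$. *)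

(* Defs.v *)
From HB Require Import structures.
From mathcomp Require Import all_boot all_order all_algebra.
From mathcomp Require Import all_classical all_reals all_analysis.
From mathcomp Require Import matrix_topology matrix_normedtype.
Set Implicit Arguments. Unset Strict Implicit. Unset Printing Implicit Defensive.
Import Order.TTheory GRing.Theory Num.Theory.
Import numFieldNormedType.Exports.
Local Open Scope ring_scope.

(* R(M): a matrix whose row space (in mxalgebra's %MS sense) is the column
   space of M; N(M): a matrix whose row space is {v | M v = 0} (transposed). *)
Definition colspace (R : fieldType) n (M : 'M[R]_n) : 'M[R]_n := M^T.
Definition nullspace (R : fieldType) n (M : 'M[R]_n) : 'M[R]_n := kermx M^T.

Definition is_index (R : fieldType) n (M : 'M[R]_n) (nu : nat) : Prop :=
  \rank (M ^+ nu.+1) = \rank (M ^+ nu) /\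
  forall k, (k < nu)%N -> \rank (M ^+ k.+1) <> \rank (M ^+ k).

Definition is_eigenproj0 (R : fieldType) n (M Z : 'M[R]_n) : Prop :=
  exists nu, is_index M nu /\ Z *m Z = Z /\
    (colspace Z == nullspace (M ^+ nu))%MS /\
    (nullspace Z == colspace (M ^+ nu))%MS.

Definition is_orth_proj (R : fieldType) n (P : 'M[R]_n) m (U : 'M[R]_(m, n)) : Prop :=
  P *m P = P /\ P^T = P /\ (colspace P == U)%MS.

Definition laplacian (R : pzRingType) n (A : 'M[R]_n) : 'M[R]_n :=
  diag_mx (A *m const_mx 1)^T - A.

Definition max_offdiag_rowsum (R : realDomainType) n (A : 'M[R]_n) : R :=
  \big[Num.max/0]_(i < n) \sum_(j < n | j != i) A i j.

(* Main.v *)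
(* The component [(1 - S) x] decays like [exp (- t / tau)], while [y = S x]
   solves [y' = - L y] because [S L = L].  Each coordinate of [y] moves towards
   weighted averages of the others, so every solution, in particular the
   velocity [v = - L y], has a nonincreasing sup norm.  Let [m] be the limit of
   that norm for [v].  If [m > 0], then for arbitrarily long times some
   coordinate of [v] stays above [m / 2] in absolute value with constant sign,
   hence the corresponding coordinate of [y] is unbounded, a contradiction; so
   [L y -> 0].  Applied to [w - t L w] with [L^2 w = 0], this gives
   [N(L^2) = N(L)], that is, [ind L <= 1], whence [Jt L = 0] and
   [1 - Jt = K L] for some [K].  So [Jt y] is constant and
   [y - Jt y = K L y -> 0]. *)
Require Import Defs.
From HB Require Import structures.
From mathcomp Require Import all_boot all_order all_algebra.
From mathcomp Require Import all_classical all_reals all_analysis.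
From mathcomp Require Import matrix_topology matrix_normedtype.
From mathcomp Require Import ring lra.
Set Implicit Arguments. Unset Strict Implicit. Unset Printing Implicit Defensive.
Import Order.TTheory GRing.Theory Num.Theory.
Import numFieldNormedType.Exports.
Local Open Scope classical_set_scope.
Local Open Scope ring_scope.

(** * Entrywise calculus of matrix-valued functions *)

Lemma mx_norm_coord_le (R : realType) (m n : nat) (M : 'M[R]_(m, n)) (e : R) :
  0 <= e -> (forall i j, `|M i j| <= e) -> `|M| <= e.
Proof.
move=> e0 Me; rewrite /Num.Def.normr/= mx_normrE.
by apply: bigmax_le => // -[i j] _; exact: Me.
Qed.

Lemma cvg_mxP (R : realType) (T : Type) (F : set_system T) {FF : Filter F}
    (m n : nat) (f : T -> 'M[R]_(m, n)) (l : 'M[R]_(m, n)) :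
  f x @[x --> F] --> l <-> forall i j, f x i j @[x --> F] --> l i j.
Proof.
split=> [fl i j|fl].
  exact: (cvg_comp _ _ fl (@coord_continuous R m n i j l)).
apply/cvgrPdist_le => e e0; near=> x.
apply: mx_norm_coord_le => [|i j]; first exact: ltW.
rewrite !mxE; move: i j; near: x; apply: filter_forall => i.
by apply: filter_forall => j; move/cvgrPdist_le : (fl i j); apply.
Unshelve. all: by end_near. Qed.

Lemma cvg_fct_sum (R : realType) (T I : Type) (F : set_system T) {FF : Filter F}
    (r : seq I) (f : I -> T -> R) (l : I -> R) :
  (forall i, f i x @[x --> F] --> l i) ->
  (\sum_(i <- r) f i x) @[x --> F] --> \sum_(i <- r) l i.
Proof.
move=> fl; elim: r => [|i r IHr].
  under eq_fun do rewrite big_nil.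
  by rewrite big_nil; exact: cvg_cst.
under eq_fun do rewrite big_cons.
by rewrite big_cons; apply: cvgD.
Qed.

Lemma cvg_mulmx (R : realType) (T : Type) (F : set_system T) {FF : Filter F}
    (m n p : nat) (K : 'M[R]_(m, n)) (f : T -> 'M[R]_(n, p))
    (l : 'M[R]_(n, p)) :
  f x @[x --> F] --> l -> (K *m f x) @[x --> F] --> K *m l.
Proof.
move/cvg_mxP => fl; apply/cvg_mxP => i j.
under eq_fun do rewrite mxE.
rewrite mxE; apply: cvg_fct_sum => k.
exact: cvgMl_tmp.
Qed.

Arguments cvg_mulmx {R T F FF m n p} K {f l} _.

Lemma is_derive_mxP (R : realType) (m n : nat) (f : R -> 'M[R]_(m, n)) (t : R)
    (df : 'M[R]_(m, n)) :
  is_derive t 1 f df <-> forall i j, is_derive t 1 (fun s => f s i j) (df i j).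
Proof.
split=> [[fd fE] i j|fd].
  have fijd := (derivable_mxP _ _ _).1 fd i j.
  by apply: DeriveDef => //; rewrite -fE derive_mx// mxE.
have fd' : derivable f t 1.
  by apply/derivable_mxP => i j; exact: ex_derive.
apply: DeriveDef => //; rewrite derive_mx//.
by apply/matrixP => i j; rewrite mxE derive_val.
Qed.

Lemma is_derive_mulmx (R : realType) (m n p : nat) (K : 'M[R]_(m, n))
    (f : R -> 'M[R]_(n, p)) (t : R) (df : 'M[R]_(n, p)) :
  is_derive t 1 f df -> is_derive t 1 (fun s => K *m f s) (K *m df).
Proof.
move/is_derive_mxP => fd; apply/is_derive_mxP => i j.
rewrite mxE (_ : (fun s => _) = \sum_k (fun s => K i k * f s k j)); last first.
  by apply/funext => s; rewrite mxE fct_sumE.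
apply: is_derive_sum.
Qed.

Arguments is_derive_mulmx {R m n p} K {f t df} _.

Lemma is_derive_nondecreasing (R : realType) (f df : R -> R) (a b : R) :
  a <= b -> (forall t, t \in `[a, b] -> is_derive t 1 f (df t)) ->
  (forall t, t \in `[a, b] -> 0 <= df t) -> f a <= f b.
Proof.
move=> ab fd df0.
have fd' t : t \in `]a, b[ -> is_derive t 1 f (df t).
  by move=> tab; apply: fd; exact: subset_itv_oo_cc.
have fc : {within `[a, b], continuous f}.
  by apply: derivable_within_continuous => t /fd [].
have [c cab E] := MVT_segment ab fd' fc.
by rewrite -subr_ge0 E mulr_ge0 ?df0// subr_ge0.
Qed.

(** * Solutions of linear systems at positive times *)

Definition flow (R : realType) n (M : 'M[R]_n) (y : R -> 'cV[R]_n) : Prop :=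
  forall t : R, 0 < t -> is_derive t 1 y (M *m y t).

(** Intertwining carries solutions to solutions. With [K = M = M'] the velocity is itself a
    solution; with [M' = 0] a left annihilator of [M] yields a conserved quantity. *)
Lemma flow_mulmx (R : realType) n (K M M' : 'M[R]_n) (y : R -> 'cV[R]_n) :
  K *m M = M' *m K -> flow M y -> flow M' (fun t => K *m y t).
Proof.
by move=> KM yM t t0; rewrite mulmxA -KM -mulmxA; exact/is_derive_mulmx/yM.
Qed.

Lemma flowN (R : realType) n (M : 'M[R]_n) (y : R -> 'cV[R]_n) :
  flow M y -> flow M (fun t => - y t).
Proof. by move=> yM t t0; rewrite mulmxN; apply: is_deriveN; exact: yM. Qed.

Lemma flow_coord (R : realType) n (M : 'M[R]_n) (y : R -> 'cV[R]_n) i (t : R) :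
  flow M y -> 0 < t -> is_derive t 1 (fun s => y s i 0) ((M *m y t) i 0).
Proof. by move=> yM t0; have /is_derive_mxP := yM _ t0; apply. Qed.

(** By the mean value theorem each coordinate is constant on positive times, and the right limit at
    0 identifies the constant. *)
Lemma flow0_cst (R : realType) n (y : R -> 'cV[R]_n) (l : 'cV[R]_n) :
  flow 0 y -> y t @[t --> 0^'+] --> l -> forall t, 0 < t -> y t = l.
Proof.
move=> y0 yl t t0; apply/matrixP => i j; rewrite ord1.
have cst a b : 0 < a -> a <= b -> y a i 0 = y b i 0.
  move=> a0 ab; apply/eqP; rewrite eq_sym -subr_eq0.
  have yd s : s \in `]a, b[ -> is_derive s 1 (fun s => y s i 0) 0.
    rewrite in_itv/= => /andP[/(lt_trans a0) s0 _].
    by have := flow_coord i y0 s0; rewrite mul0mx mxE.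
  have yc : {within `[a, b], continuous (fun s => y s i 0)}.
    apply: derivable_within_continuous => s.
    rewrite in_itv/= => /andP[/(lt_le_trans a0) s0 _].
    by have [] := flow_coord i y0 s0.
  have [c _ ->] := @MVT_segment R (fun s => y s i 0) (fun=> 0) a b ab yd yc.
  by rewrite mul0r.
have yl0 : y s i 0 @[s --> 0^'+] --> l i 0 by move/cvg_mxP : yl; apply.
apply: cvg_unique yl0 => //=.
apply: (@cvg_trans _ ((fun=> y t i 0) @ 0^'+)); last exact: cvg_cst.
apply: near_eq_cvg; near=> s.
have s0 : 0 < s by near: s; exact: nbhs_right_gt.
by have [/(cst _ _ s0)/= ->|/ltW/(cst _ _ t0)/= ->] := leP s t.
Unshelve. all: by end_near. Qed.

(** * Maximum principle for generators with zero row sums and nonnegative off-diagonal entries *)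

Section stochastic_flow.
Context {R : realType} {n : nat}.
Variables (M : 'M[R]_n) (d : R).
Hypothesis M1 : M *m (const_mx 1 : 'cV[R]_n) = 0.
Hypothesis dM : forall i j, 0 <= (d%:M + M) i j.

Implicit Types y v : R -> 'cV[R]_n.

(** Apply [d%:M + M] to [K *: const_mx 1 - v]: [M] kills the constant vector. When [K] bounds all
    coordinates of [v], the sum has only nonnegative terms. *)
Lemma mulmx_drift (v : 'cV[R]_n) (K : R) i :
  d * (K - v i 0) - (M *m v) i 0 =
  \sum_j (d%:M + M) i j * (K - v j 0).
Proof.
have -> : \sum_j (d%:M + M) i j * (K - v j 0) =
    ((d%:M + M) *m (K *: const_mx 1 - v)) i 0.
  by rewrite [RHS]mxE; apply: eq_bigr => j _; rewrite !mxE mulr1.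
rewrite mulmxDl mul_scalar_mx mulmxBr -scalemxAr M1 scaler0 sub0r.
by rewrite !mxE mulr1.
Qed.

(* A coordinate close to an upper bound of all of them was already close to it
   before, since exp (d t) (K - v_i t) is nondecreasing. *)
Lemma flow_gap_le v (K s u : R) i : flow M v -> 0 < u -> u <= s ->
  (forall t j, t \in `[u, s] -> v t j 0 <= K) ->
  K - v u i 0 <= expR (d * (s - u)) * (K - v s i 0).
Proof.
move=> vM u0 us vK.
pose f t := expR (d * t) * (K - v t i 0).
pose df t := expR (d * t) * (d * (K - v t i 0) - (M *m v t) i 0).
have : f u <= f s.
  apply: (@is_derive_nondecreasing R f df) => // t tus.
  - have t0 : 0 < t by move: tus; rewrite in_itv/= => /andP[/(lt_le_trans u0)].
    have vt := flow_coord i vM t0.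
    rewrite /f /df; apply: is_derive_eq.
    by rewrite /GRing.scale/= !mulr1 add0r; ring.
  - rewrite /df mulmx_drift mulr_ge0 ?expR_ge0// sumr_ge0// => j _.
    by rewrite mulr_ge0// subr_ge0 vK.
rewrite /f -(ler_pM2l (expR_gt0 (- (d * u)))) !mulrA -!expRD addNr expR0 mul1r.
by rewrite (_ : - (d * u) + d * s = d * (s - u))//; ring.
Qed.

Lemma flow_le v (K a t : R) : flow M v -> 0 < a -> a <= t ->
  (forall j, v a j 0 <= K) -> forall j, v t j 0 <= K.
Proof.
move=> vM a0 lat vK j.
have vmax k : exists c, c \in `[a, t] /\
    forall s, s \in `[a, t] -> v s k 0 <= v c k 0.
  have vc : {within `[a, t], continuous (fun s => v s k 0)}.
    apply: derivable_within_continuous => s.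
    rewrite in_itv/= => /andP[/(lt_le_trans a0) s0 _].
    by have [] := flow_coord k vM s0.
  by have [c cat cmax] := EVT_max lat vc; exists c.
have [c cP] := choice vmax.
(* [v (c i) i 0] is the maximum over all coordinates and all times in [[a, t]]. *)
pose i := [arg max_(k > j) v (c k) k 0]%O.
have imax k : v (c k) k 0 <= v (c i) i 0.
  by rewrite /i; case: arg_maxP => // ? _; apply.
have [ci cimax] := cP i.
have /andP[aci cit] : (a <= c i) && (c i <= t) by move: ci; rewrite in_itv.
(* Taking this maximum as upper bound, the gap at time [c i] is zero, hence it was already zero at
   time [a], where [K] is a bound. *)
have := @flow_gap_le v (v (c i) i 0) (c i) a i vM a0 aci.
rewrite subrr mulr0 subr_le0 => H.
have {}H : v (c i) i 0 <= v a i 0.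
  apply: H => s k; rewrite in_itv/= => /andP[as_ sci].
  apply: le_trans (imax k); apply (cP k).2.
  by rewrite in_itv/= as_ (le_trans sci).
apply: le_trans (vK i); apply: le_trans H; apply: le_trans (imax j).
by apply (cP j).2; rewrite in_itv/= lat lexx.
Qed.

Lemma flow_norm_le v (K a t : R) : flow M v -> 0 < a -> a <= t ->
  (forall j, `|v a j 0| <= K) -> forall j, `|v t j 0| <= K.
Proof.
move=> vM a0 lat vK j; rewrite ler_norml lerNl; apply/andP; split.
  suff : (- v t) j 0 <= K by rewrite mxE.
  apply: (flow_le (flowN vM) a0 lat) => k.
  by rewrite mxE lerNl; move: (vK k); rewrite ler_norml => /andP[].
apply: (flow_le vM a0 lat) => k.
by move: (vK k); rewrite ler_norml => /andP[].
Qed.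

End stochastic_flow.

(** * Decay of the velocity *)

Section stochastic_decay.
Context {R : realType} {n : nat}.
Variables (M : 'M[R]_n) (d : R).
Hypothesis M1 : M *m (const_mx 1 : 'cV[R]_n) = 0.
Hypothesis dM : forall i j, 0 <= (d%:M + M) i j.
Hypothesis d0 : 0 <= d.

Implicit Types y : R -> 'cV[R]_n.

(* Otherwise the velocity of [y_i] would exceed [m / 2] during a time [T], and
   [y_i] would move by more than the [2 B] that its bound allows. *)
Lemma flow_velocity_lt y (B m e T a : R) : flow M y -> 0 < a -> 0 <= T ->
  (forall t j, a <= t -> `|y t j 0| <= B) ->
  (forall t j, a <= t -> (M *m y t) j 0 <= m + e) ->
  0 <= e -> expR (d * T) * (2 * e) <= m / 2 -> 2 * B < T * (m / 2) ->
  forall i, (M *m y (a + T)) i 0 < m - e.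
Proof.
move=> yM a0 T0 yB vm e0 eT BT i; rewrite ltNge; apply/negP => vi.
have vM : flow M (fun t => M *m y t) by exact: flow_mulmx yM.
have aT : a <= a + T by rewrite lerDl.
have v_ge t : t \in `[a, a + T] -> m / 2 <= (M *m y t) i 0.
  rewrite in_itv/= => /andP[at_ taT].
  have t0 : 0 < t by exact: lt_le_trans at_.
  have := flow_gap_le M1 dM i (K := m + e) vM t0 taT.
  move=> /(_ _)/wrap[s j|gap].
    by rewrite in_itv/= => /andP[ts _]; rewrite vm// (le_trans at_).
  (* If the claim fails, the gap to [m + e] at the end time is at most [2 * e]; carried back over a
     time at most [T] it is at most [m / 2]. *)
  have : expR (d * (a + T - t)) * (m + e - (M *m y (a + T)) i 0) <= m / 2.
    apply: le_trans eT; apply: ler_pM; rewrite ?expR_ge0//.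
    - by rewrite subr_ge0 vm.
    - by rewrite ler_expR ler_wpM2l//; lra.
    - by lra.
  by move: gap => /= gap gap'; have := le_trans gap gap'; lra.
have yd t : t \in `[a, a + T] ->
    is_derive t 1 (fun s => y s i 0 - m / 2 * s) ((M *m y t) i 0 - m / 2).
  rewrite in_itv/= => /andP[at_ taT].
  have t0 : 0 < t by exact: lt_le_trans at_.
  have yt := flow_coord i yM t0.
  by apply: is_derive_eq; rewrite /GRing.scale/= mulr1.
have := is_derive_nondecreasing aT yd.
move=> /(_ _)/wrap[t /v_ge|]; first by rewrite subr_ge0.
have := yB _ i (lexx a); have := yB _ i aT; rewrite !ler_norml.
by move=> /andP[_ +] /andP[+ _]; lra.
Qed.

Lemma flow_velocity_cvg0 y : flow M y -> (M *m y t) @[t --> +oo] --> (0 : 'cV[R]_n).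
Proof.
move=> yM.
have vM : flow M (fun t => M *m y t) by exact: flow_mulmx yM.
pose bnd (K : R) := exists2 a : R, 0 < a &
  forall t j, a <= t -> `|(M *m y t) j 0| <= K.
have norm_ge (t : R) j : `|(M *m y t) j 0| <= `|M *m y t|.
  by rewrite [leRHS]/Num.Def.normr/= mx_normrE (le_bigmax _ _ (j, ord0)).
have ynorm_ge (t : R) j : `|y t j 0| <= `|y t|.
  by rewrite [leRHS]/Num.Def.normr/= mx_normrE (le_bigmax _ _ (j, ord0)).
(* The eventual bounds of the velocity; as its sup norm never grows, their infimum [m] is the limit
   of that norm. *)
pose E := [set K | 0 <= K /\ bnd K].
have E0 : E !=set0.
  exists `|M *m y 1|; split => //; exists 1 => // t j t1.
  exact: (flow_norm_le M1 dM vM _ t1).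
have Elb : has_lbound E by exists 0 => K [].
pose m := inf E.
have m0 : 0 <= m by apply: lb_le_inf => // K [].
have mE e : 0 < e -> bnd (m + e).
  move=> e0; have [K [_ [a a0 aK]] Km] := inf_adherent e0 (conj E0 Elb).
  by exists a => // t j at_; apply: le_trans (ltW Km); exact: aK.
suff mE0 : m = 0.
  apply/cvg_mxP => i j; rewrite mxE ord1; apply/cvgrPdist_le => e e0.
  have [a a0 ae] := mE _ e0.
  near=> t; rewrite sub0r normrN -[leRHS]add0r -mE0 ae//.
apply/eqP; rewrite eq_le m0 andbT leNgt; apply/negP => m_gt0.
pose B := `|y 1|.
(* Chosen so that [T * (m / 2) = 2 * B + 1], more than two values bounded by [B] can differ. *)
pose T := (4 * B + 2) / m.
have B0 : 0 <= B by exact: normr_ge0.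
have T0 : 0 <= T by rewrite divr_ge0// addr_ge0// mulr_ge0.
have BT : 2 * B < T * (m / 2).
  rewrite (_ : T * (m / 2) = 2 * B + 1) ?ltrDl// /T.
  by field; rewrite gt_eqF.
(* Chosen so that [expR (d * T) * (2 * e)] equals [m / 2]. *)
pose e := m / 4 * expR (- (d * T)).
have e0 : 0 < e by rewrite mulr_gt0 ?expR_gt0// divr_gt0.
have eT : expR (d * T) * (2 * e) <= m / 2.
  rewrite [leLHS](_ : _ = m / 2 * (expR (d * T) * expR (- (d * T)))).
    by rewrite -expRD subrr expR0 mulr1.
  by rewrite /e; field.
have [a' a'0 va'] := mE _ e0.
pose a := Num.max 1 a'.
have a_ge1 : 1 <= a by rewrite le_max lexx.
have a0 : 0 < a by exact: lt_le_trans a_ge1.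
have yB t j : a <= t -> `|y t j 0| <= B.
  by move=> at_; apply: (flow_norm_le M1 dM yM _ (le_trans a_ge1 at_)).
have va t j : a <= t -> `|(M *m y t) j 0| <= m + e.
  by move=> at_; apply: va'; apply: le_trans at_; rewrite le_max lexx orbT.
have lt_me j : `|(M *m y (a + T)) j 0| < m - e.
  rewrite ltr_norml ltrNl; apply/andP; split; last first.
    apply: (flow_velocity_lt yM a0 T0 yB _ (ltW e0) eT BT) => t k at_.
    exact: le_trans (ler_norm _) (va t k at_).
  have := @flow_velocity_lt _ B m e T a (flowN yM) a0 T0 _ _ (ltW e0) eT BT j.
  rewrite mulmxN mxE; apply => t k at_; rewrite ?mulmxN mxE.
    by rewrite normrN yB.
  by apply: le_trans (va t k at_); rewrite -normrN ler_norm.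
(* At time [a + T] all velocities are below [m - e] in absolute value, so [m - e] is an eventual
   bound smaller than the infimum. *)
suff : m <= m - e by rewrite leNgt ltrBlDr ltrDl e0.
apply: ge_inf => //; split.
  rewrite subr_ge0 /e -[leRHS]mulr1 ler_pM ?expR_ge0//.
  - by rewrite divr_ge0.
  - by rewrite ler_pdivrMr// ler_peMr// ler1n.
  - by rewrite -expR0 ler_expR oppr_le0 mulr_ge0.
exists (a + T) => [|t j at_]; first by rewrite ltr_pwDl.
apply: (flow_norm_le M1 dM vM _ at_) => [|k]; first by rewrite ltr_pwDl.
exact/ltW/lt_me.
Unshelve. all: by end_near. Qed.

End stochastic_decay.

(** * Laplacian matrices, their index and their flows *)

Lemma laplacian_mulmx1 (R : pzRingType) n (A : 'M[R]_n) :
  laplacian A *m (const_mx 1 : 'cV[R]_n) = 0.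
Proof.
apply/matrixP => i j; rewrite mulmxBl mul_diag_mx !mxE mulr1.
apply/eqP; rewrite subr_eq0; apply/eqP.
by apply: eq_bigr => k _; rewrite !mxE.
Qed.

(** The entry is [A i j] plus, on the diagonal, [d] minus a row sum of [A]; the sum of all entries
    dominates every row sum. *)
Lemma oppr_laplacian_ge0 (R : realDomainType) n (A : 'M[R]_n) :
  (forall i j, 0 <= A i j) ->
  exists2 d, 0 <= d & forall i j, 0 <= (d%:M + - laplacian A) i j.
Proof.
move=> A0; pose d := \sum_i \sum_j A i j.
have rows0 i : 0 <= \sum_j A i j by apply: sumr_ge0 => j _.
exists d => [|i j]; first by apply: sumr_ge0 => i _.
rewrite !mxE opprB addrCA addr_ge0// -mulrnBl mulrn_wge0// subr_ge0.
rewrite (_ : \sum_k _ = \sum_k A i k); last first.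
  by apply: eq_bigr => k _; rewrite mxE mulr1.
by rewrite /d [leRHS](bigD1 i)//= lerDl sumr_ge0.
Qed.

(** The columns of [cokermx B] lie in the kernel of [B], so [K] kills them, which is the criterion
    for row space inclusion. *)
Lemma mulmx_factor_ker (F : fieldType) m p n (B : 'M[F]_(m, n))
    (K : 'M[F]_(p, n)) :
  (forall w : 'cV[F]_n, B *m w = 0 -> K *m w = 0) -> exists K', K = K' *m B.
Proof.
move=> BK; suff /submxP : (K <= B)%MS by [].
rewrite submxE; apply/eqP/matrixP => i j.
have := BK (col j (cokermx B)); rewrite !colE (mulmxA B) (mulmxA K) mulmx_coker mul0mx.
by move=> /(_ erefl); rewrite -colE => /matrixP/(_ i ord0); rewrite !mxE.
Qed.

Section laplacian_flow.
Context {R : realType} {n : nat}.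
Variable A : 'M[R]_n.
Hypothesis A0 : forall i j, 0 <= A i j.

Let L := laplacian A.

Let opp_L1 : - L *m (const_mx 1 : 'cV[R]_n) = 0.
Proof. by rewrite mulNmx laplacian_mulmx1 oppr0. Qed.

Lemma laplacian_flow_cvg0 (y : R -> 'cV[R]_n) :
  flow (- L) y -> (L *m y t) @[t --> +oo] --> (0 : 'cV[R]_n).
Proof.
have [d d0 dL] := oppr_laplacian_ge0 A0.
move=> yL; rewrite -[0]oppr0 (_ : (fun t => _) = fun t => - (- L *m y t)).
  by apply: cvgN; exact: (flow_velocity_cvg0 opp_L1 dL d0).
by apply/funext => t; rewrite mulNmx opprK.
Qed.

(* If L^2 w = 0, the affine curve w - t L w solves y' = - L y, so its constant
   velocity vanishes. *)
Lemma ker_laplacian_sqr (w : 'cV[R]_n) : L *m (L *m w) = 0 -> L *m w = 0.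
Proof.
move=> LLw; pose y (t : R) := w - t *: (L *m w).
have Ly t : L *m y t = L *m w.
  by rewrite mulmxBr -scalemxAr LLw scaler0 subr0.
have yL : flow (- L) y.
  move=> t t0; apply/is_derive_mxP => i j; rewrite mulNmx Ly mxE.
  rewrite (_ : (fun s => _) = fun s => w i j - (L *m w) i j * s).
    by apply: is_derive_eq; rewrite /GRing.scale/=; ring.
  by apply/funext => s; rewrite !mxE mulrC.
have := laplacian_flow_cvg0 yL; under eq_fun do rewrite Ly.
by move=> /(cvg_lim (@norm_hausdorff _ _)) <-; rewrite lim_cst.
Qed.

(** Equal kernels make [L] a left multiple of [L *m L], so the two ranks agree and minimality of
    [nu] would fail at exponent 1. *)
Lemma is_index_laplacian nu : is_index L nu -> (nu <= 1)%N.
Proof.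
move=> [_ numin]; rewrite leqNgt; apply/negP => /numin; apply.
have [|K LK] := @mulmx_factor_ker _ _ _ _ (L *m L) L.
  by move=> w; rewrite -mulmxA; exact: ker_laplacian_sqr.
apply/eqP; rewrite expr2 expr1 eqn_leq mxrankM_maxr/=.
by rewrite {1}LK mxrankM_maxr.
Qed.

(** [Z] kills the range of [L ^+ nu], which contains that of [L] as [nu <= 1]. The kernel of [L]
    lies in that of [L ^+ nu], the range of [Z], so [1%:M - Z] kills it. *)
Lemma eigenproj0_laplacian (Z : 'M[R]_n) : is_eigenproj0 L Z ->
  Z *m L = 0 /\ exists K, 1%:M - Z = K *m L.
Proof.
move=> [nu [indL [ZZ [/andP[_ NZ] /andP[_ RZ]]]]].
have nu1 := is_index_laplacian indL.
have ZLnu : Z *m L ^+ nu = 0.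
  by apply: trmx_inj; rewrite trmx_mul trmx0; exact/sub_kermxP.
split.
  have := nu1; rewrite leq_eqVlt ltnS leqn0 => /orP[]/eqP nuE.
    by move: ZLnu; rewrite nuE expr1.
  by move: ZLnu; rewrite nuE expr0 mulmx1 => ->; rewrite mul0mx.
apply: mulmx_factor_ker => w Lw.
(* The rank equality makes [L ^+ nu] a left multiple of [L ^+ nu.+1], so this holds for [nu = 0]
   too. *)
have Lnuw : L ^+ nu *m w = 0.
  have [rankL _] := indL.
  have : (L ^+ nu <= L ^+ nu.+1)%MS.
    have sub : (L ^+ nu.+1 <= L ^+ nu)%MS by rewrite exprS submxMl.
    by rewrite -(geq_leqif (mxrank_leqif_sup sub)) rankL.
  by move=> /submxP[K ->]; rewrite exprSr -!mulmxA Lw !mulmx0.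
have /submxP[u wE] : (w^T <= Z^T)%MS.
  apply: submx_trans NZ; apply/sub_kermxP.
  by rewrite -trmx_mul Lnuw trmx0.
have {}wE : w = Z *m u^T by rewrite -[w]trmxK wE trmx_mul trmxK.
by rewrite mulmxBl mul1mx wE mulmxA ZZ subrr.
Qed.

Lemma laplacian_flow_cvg (Z : 'M[R]_n) (y : R -> 'cV[R]_n) (y0 : 'cV[R]_n) :
  is_eigenproj0 L Z -> flow (- L) y -> y t @[t --> 0^'+] --> y0 ->
  y t @[t --> +oo] --> Z *m y0.
Proof.
move=> /eigenproj0_laplacian[ZL [K ZK]] yL y0cvg.
have Zflow : flow 0 (fun t => Z *m y t).
  by apply: flow_mulmx yL; rewrite mulmxN ZL mul0mx oppr0.
have Zy t : 0 < t -> Z *m y t = Z *m y0.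
  exact: (flow0_cst Zflow (cvg_mulmx Z y0cvg)).
have KL0 : (K *m (L *m y t)) @[t --> +oo] --> K *m (0 : 'cV[R]_n).
  exact: cvg_mulmx (laplacian_flow_cvg0 yL).
set z0 : 'cV[R]_n := Z *m y0 in Zy *.
have : (K *m (L *m y t) + z0 : 'cV[R]_n) @[t --> +oo] --> (K *m 0 + z0 : 'cV[R]_n).
  by apply: cvgD; [exact: KL0|exact: cvg_cst].
rewrite mulmx0 add0r; apply: (cvg_trans (near_eq_cvg _)); near=> t.
have t0 : 0 < t by near: t; exact: nbhs_pinfty_gt.
by rewrite -(Zy t t0) mulmxA -ZK mulmxBl mul1mx subrK.
Unshelve. all: by end_near. Qed.

End laplacian_flow.

(** * The relaxing component and the assembled limit *)

Lemma relaxation_cvg0 (R : realType) n (q : R -> 'cV[R]_n) (c : R)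
    (q0 : 'cV[R]_n) : 0 < c ->
  (forall t : R, 0 < t -> is_derive t 1 q (- c *: q t)) ->
  q t @[t --> 0^'+] --> q0 -> q t @[t --> +oo] --> (0 : 'cV[R]_n).
Proof.
(* Integrating factor: [p] has zero derivative, so [q t] is [expR (- (c * t)) *: q0]. *)
move=> c0 qd qq0; pose p t := expR (c * t) *: q t.
have p_flow : flow 0 p.
  move=> t t0; rewrite mul0mx; apply/is_derive_mxP => i j; rewrite mxE.
  have /is_derive_mxP/(_ i j) := qd _ t0; rewrite mxE => qij.
  rewrite (_ : (fun s => _) = fun s => expR (c * s) * q s i j).
    by apply: is_derive_eq; rewrite /GRing.scale/=; ring.
  by apply/funext => s; rewrite mxE.
have expc (b : R) : (expR (b * t)) @[t --> 0^'+] --> (1 : R).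
  rewrite -(expR0 R) -[X in expR X](mulr0 b); apply: cvg_at_right_filter.
  apply: (@cvg_comp _ _ _ (fun t => b * t) expR); last exact: continuous_expR.
  by apply: cvgMl_tmp; exact: cvg_id.
have pq0 : p t @[t --> 0^'+] --> q0.
  by rewrite -[q0]scale1r; apply: cvgZ.
have pE := flow0_cst p_flow pq0.
have : (expR (- (c * t)) *: q0) @[t --> +oo] --> (0 *: q0).
  apply: cvgZr_tmp.
  apply: (@cvg_comp _ _ _ (fun t => c * t) (fun x => expR (- x))); last exact: cvgr_expR.
  by apply: gt0_cvgMry => //; exact: cvg_id.
rewrite scale0r; apply: (cvg_trans (near_eq_cvg _)); near=> t.
have t0 : 0 < t by near: t; exact: nbhs_pinfty_gt.
by rewrite -(pE t t0) /p scalerA -expRD addNr expR0 scale1r.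
Unshelve. all: by end_near. Qed.

Theorem theorem6 (R : realType) (n : nat) (A : 'M[R]_n) (tau : R)
    (S Jt : 'M[R]_n) (x : R -> 'cV[R]_n) :
  (forall i j, 0 <= A i j) ->
  0 < tau -> tau * max_offdiag_rowsum A <= 1 ->
  is_orth_proj S ((colspace (laplacian A)) + (const_mx 1 : 'rV[R]_n))%MS ->
  is_eigenproj0 (laplacian A) Jt ->
  (forall t, 0 < t ->
     derivable x t 1 /\
     'D_1 x t = - ((tau^-1 *: (1%:M - S) + laplacian A *m S) *m x t)) ->
  x t @[t --> at_right 0] --> x 0 ->
  x t @[t --> +oo] --> Jt *m S *m x 0.
Proof.
move=> A0 tau0 _ [SS [_ /andP[_ US]]] JtL xsol x0.
set L := laplacian A in US JtL xsol *.
(* The columns of [L] lie in the range of [S], which [S] fixes pointwise. *)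
have SL : S *m L = L.
  have /submxP[K LK] : (L^T <= S^T)%MS.
    by apply: submx_trans US; exact: addsmxSl.
  by rewrite -[L]trmxK LK trmx_mul trmxK mulmxA SS.
have xd (t : R) : 0 < t ->
    is_derive t 1 x (- ((tau^-1 *: (1%:M - S) + L *m S) *m x t)).
  by move=> t0; have [? ?] := xsol _ t0; apply: DeriveDef.
(* This identity and the next decouple the system into [S *m x], driven by [- L], and
   [(1%:M - S) *m x], decaying at rate [tau^-1]. *)
have SM : S *m (tau^-1 *: (1%:M - S) + L *m S) = L *m S.
  rewrite mulmxDr -scalemxAr mulmxA SL mulmxBr mulmx1 SS subrr scaler0.
  by rewrite add0r.
have QM : (1%:M - S) *m (tau^-1 *: (1%:M - S) + L *m S) =
    tau^-1 *: (1%:M - S).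
  have QL : (1%:M - S) *m L = 0 by rewrite mulmxBl mul1mx SL subrr.
  rewrite mulmxDr -scalemxAr mulmxA QL mul0mx addr0 mulmxBr mulmx1.
  by rewrite mulmxBl mul1mx SS subrr subr0.
have Sflow : flow (- L) (fun t => S *m x t).
  move=> t t0; have := is_derive_mulmx S (xd _ t0).
  by rewrite mulmxN (mulmxA S) SM mulNmx (mulmxA L).
have Qd (t : R) : 0 < t -> is_derive t 1 (fun s => (1%:M - S) *m x s)
    (- tau^-1 *: ((1%:M - S) *m x t)).
  move=> t0; have := is_derive_mulmx (1%:M - S) (xd _ t0).
  by rewrite mulmxN (mulmxA (1%:M - S)) QM -scalemxAl scaleNr.
have Scvg : (S *m x t) @[t --> +oo] --> Jt *m (S *m x 0).
  exact: (laplacian_flow_cvg A0 JtL Sflow (cvg_mulmx S x0)).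
have Qcvg : ((1%:M - S) *m x t) @[t --> +oo] --> (0 : 'cV[R]_n).
  apply: (relaxation_cvg0 _ Qd (cvg_mulmx (1%:M - S) x0)).
  by rewrite invr_gt0.
have : (S *m x t + (1%:M - S) *m x t) @[t --> +oo] -->
    (Jt *m (S *m x 0) + 0 : 'cV[R]_n).
  by apply: cvgD; [exact: Scvg|exact: Qcvg].
rewrite addr0 mulmxA.
by under eq_fun do rewrite -mulmxDl addrC subrK mul1mx.
Qed.
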